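(* Let $\{((A_n,L_{A_n}),\phi_n)\}_{n\ge1}$ and $\{((B_n,L_{B_n}),\varphi_n)\}_{n\ge1}$ be two inductive sequences of compact quantum metric spaces, with inductive limits $A=\varinjlim(A_n,\phi_n)$ and $B=\varinjlim(B_n,\varphi_n)$, canonical maps $\phi^n:A_n\to A$ and $\varphi^n:B_n\to B$, and canonical Lip-norms $L_A$ on $A$ and $L_B$ on $B$ (defined in the context). Suppose that for each $n\in\mathbb{N}$ there are unital $^*$-homomorphisms $\psi_n:A_n\to B_n$ and $\Psi_n:B_n\to A_{n+1}$ such that $\Psi_n\circ\psi_n=\phi_n$, $\psi_{n+1}\circ\Psi_n=\varphi_n$ and $\psi_{n+1}\circ\phi_n=\varphi_n\circ\psi_n$ for all $n$. Suppose there are bounded sequences of positive real numbers $\{\lambda_n\}$ and $\{\gamma_n\}$ such that for all $n\in\mathbb{N}$ $$L_B((\varphi^n\circ\psi_n)(a))\le\lambda_nL_{A_n}(a)\ \text{ for all } a\in A_n,\qquad L_A((\phi^{n+1}\circ\Psi_n)(b))\le\gamma_nL_{B_n}(b)\ \text{ for all } b\in B_n.$$ Then there are unique unital $^*$-homomorphisms $\psi:A\to B$ and $\Psi:B\to A$ such that (1) $\psi\circ\Psi=\mathrm{id}_B$ and $\Psi\circ\psi=\mathrm{id}_A$; (2) for each $n\in\mathbb{N}$, $\psi\circ\phi^n=\varphi^n\circ\psi_n$, $\Psi\circ\varphi^n=\phi^{n+1}\circ\Psi_n$ and $\phi^{n+1}\circ\Psi_n\circ\psi_n=\phi^n$; (3)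 for any $a\in A$, $L_B(\psi(a))\le 2\sup\{\lambda_n:n\in\mathbb{N}\}L_A(a)$; (4) for any $b\in B$, $L_A(\Psi(b))\le 2\sup\{\gamma_n:n\in\mathbb{N}\}L_B(b)$. Therefore, the compact quantum metric spaces $(A,L_A)$ and $(B,L_B)$ are Lipschitz isomorphic.
   Context: For a unital $C^*$-algebra $A$, $\mathbf{1}_A$ is its identity and $\mathcal{S}(A)$ its state space. A Lipschitz seminorm on $A$ is a seminorm $L:A\to[0,+\infty]$ (the value $+\infty$ is permitted) such that (1) $L(a^* )=L(a)$ for all $a\in A$; (2) $L(a)=0$ if and only if $a\in\mathbb{C}\mathbf{1}_A$; (3) $\mathrm{dom}(L)=\{a\in A: L(a)<+\infty\}$ is a (norm-)dense subspace of $A$. A Lip-norm on $A$ is a Lipschitz seminorm $L$ such that the topology on $\mathcal{S}(A)$ induced by the Monge-Kantorovich metric $\rho_L(\mu,\nu)=\sup\{|\mu(a)-\nu(a)|: a\in A,\ L(a)\le 1\}$ coincides with the weak$^*$-topology. A compact quantum metric space is a pair $(A,L)$ with $A$ a unital $C^*$-algebra and $L$ a Lip-norm on $A$. An inductive sequence of compact quantum metric spaces $\{((A_n,L_n),\phi_n)\}_{n\ge1}$ consists of compact quantum metric spaces $(A_n,L_n)$ and unital $^*$-homomorphisms $\phi_n:A_n\to A_{n+1}$ (not assumed injective) with $\phi_n(\mathrm{dom}(L_n))\subset\mathrm{dom}(L_{n+1})$ for all $n$. The canonical maps $\phi^n:A_n\to A=\varinjlim(A_n,\phi_n)$ satisfy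 $\phi^{n+1}\circ\phi_n=\phi^n$. Canonical Lip-norm of the inductive limit: on $\mathcal{S}(A)$ define the metric $\rho(\mu,\nu)=\sum_{n=1}^\infty 2^{-n}\frac{\rho_{L_n}(\mu\circ\phi^n,\nu\circ\phi^n)}{1+\rho_{L_n}(\mu\circ\phi^n,\nu\circ\phi^n)}$, and for $a\in A$ put $L(a)=\sup\{|\mu(a)-\nu(a)|/\rho(\mu,\nu):\mu,\nu\in\mathcal{S}(A),\mu\ne\nu\}\in[0,+\infty]$; this is a lower semicontinuous Lip-norm on $A$. Here $L_A$ is this seminorm for $\{((A_n,L_{A_n}),\phi_n)\}$, and $L_B$ is this seminorm for $\{((B_n,L_{B_n}),\varphi_n)\}$. Compact quantum metric spaces $(A,L_A)$ and $(B,L_B)$ are Lipschitz isomorphic if there is a unital $^*$-isomorphism $\Theta$ from $A$ onto $B$ (a Lipschitz isomorphism) and constants $\lambda,\gamma>0$ with $L_B(\Theta(a))\le\lambda L_A(a)$ and $L_A(\Theta^{-1}(b))\le\gamma L_B(b)$ for all $a\in A$, $b\in B$. *)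

(* Defs.v *)
From HB Require Import structures.
From mathcomp Require Import all_boot all_order all_algebra.
From mathcomp Require Import complex.
From mathcomp Require Import all_classical all_reals all_analysis.

Set Implicit Arguments.
Unset Strict Implicit.
Unset Printing Implicit Defensive.

Import Order.TTheory GRing.Theory Num.Theory.
Import numFieldNormedType.Exports.

Local Open Scope classical_set_scope.
Local Open Scope ring_scope.
Local Open Scope complex_scope.

(* Unital C*-algebras.  The multiplication is a field of the mixin, and not a
   ring structure, because a MathComp type that is both a ring and normed has to
   be a numDomainType.  The zero algebra is allowed. *)
HB.mixin Record isCStarAlgebra (R : realType) A
    of CompleteNormedModule R[i] A := {
  cmul : A -> A -> A;
  cone : A;
  star : A -> A;
  cmulA : associative cmul;
  cmul1a : left_id cone cmul;
  cmula1 : right_id cone cmul;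
  cmulDl : left_distributive cmul +%R;
  cmulDr : right_distributive cmul +%R;
  cmulZl : forall (c : R[i]) a b, cmul (c *: a) b = c *: cmul a b;
  cmulZr : forall (c : R[i]) a b, cmul a (c *: b) = c *: cmul a b;
  starK : involutive star;
  starD : {morph star : a b / a + b};
  starZ : forall (c : R[i]) a, star (c *: a) = c^* *: star a;
  starM : forall a b, star (cmul a b) = cmul (star b) (star a);
  cstar_normM : forall a b : A, `|cmul a b| <= `|a| * `|b|;
  cstar_norm : forall a : A, `|cmul (star a) a| = `|a| ^+ 2
}.

#[short(type="cstarAlgType")]
HB.structure Definition CStarAlgebra (R : realType) :=
  {A of CompleteNormedModule R[i] A & isCStarAlgebra R A}.

Arguments cone {R s}.

Record unital_star_hom (R : realType) (A B : cstarAlgType R) := UnitalStarHom {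
  star_hom_fun :> {linear A -> B};
  star_homM : {morph star_hom_fun : a b / cmul a b};
  star_hom1 : star_hom_fun cone = cone;
  star_hom_star : {morph star_hom_fun : a / star a}
}.

(* In R[i], [0 <= z] means that z is real and nonnegative. *)
Record state (R : realType) (A : cstarAlgType R) := State {
  state_fun :> {scalar A};
  state_ge0 : forall a, 0 <= state_fun (cmul (star a) a);
  state1 : state_fun cone = 1
}.

Section PullbackState.
Variables (R : realType) (A B : cstarAlgType R).
Variables (mu : state B) (f : unital_star_hom A B).

Let mu_f : {scalar A} := state_fun mu \o star_hom_fun f.

Lemma pullback_state_ge0 a : 0 <= mu_f (cmul (star a) a).
Proof. by rewrite /mu_f /= star_homM star_hom_star state_ge0. Qed.

Lemma pullback_state1 : mu_f cone = 1.
Proof. by rewrite /mu_f /= star_hom1 state1. Qed.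

Definition pullback_state : state A := State pullback_state_ge0 pullback_state1.
End PullbackState.

Section LipNorm.
Variables (R : realType) (A : cstarAlgType R).
Local Open Scope ereal_scope.

Definition state_dist (mu nu : state A) (a : A) : \bar R :=
  (complex.Re `|(mu a - nu a)%R|)%:E.

Record lipschitz_seminorm (L : A -> \bar R) : Prop := LipschitzSeminorm {
  lip_ge0 : forall a, 0 <= L a;
  (* here 0 * +oo = 0 *)
  lip_scale : forall (c : R[i]) a, L (c *: a)%R = (complex.Re `|c|%R)%:E * L a;
  lip_add : forall a b, L (a + b)%R <= L a + L b;
  lip_star : forall a, L (star a) = L a;
  lip_eq0 : forall a, L a = 0 <-> exists c : R[i], a = (c *: cone)%R;
  lip_dense : dense [set a | L a < +oo]
}.

Definition mk_dist (L : A -> \bar R) (mu nu : state A) : \bar R :=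
  ereal_sup [set state_dist mu nu a | a in [set a | L a <= 1]].

Definition mk_open (L : A -> \bar R) (U : set (state A)) : Prop :=
  forall mu, U mu -> exists2 e : R, (0 < e)%R &
    forall nu, mk_dist L mu nu < e%:E -> U nu.

Definition weak_star_open (U : set (state A)) : Prop :=
  exists2 V : set {ptws A -> R[i]^o}, open V &
    U = (fun mu : state A => (mu : A -> R[i])) @^-1` V.

Definition lip_norm (L : A -> \bar R) : Prop :=
  lipschitz_seminorm L /\ forall U, mk_open L U <-> weak_star_open U.
End LipNorm.

Record cqms (R : realType) := CQMS {
  cqms_alg :> cstarAlgType R;
  cqms_lip : cqms_alg -> \bar R;
  cqms_lipP : lip_norm cqms_lip
}.

Definition dom_preserving (R : realType) (X Y : cqms R)
    (f : unital_star_hom X Y) : Prop :=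
  f @` [set a | cqms_lip a < +oo]%E `<=` [set b | cqms_lip b < +oo]%E.

(* Universal property in the category of unital C*-algebras and unital
   *-homomorphisms. *)
Definition is_inductive_limit (R : realType) (X : nat -> cstarAlgType R)
    (f : forall n, unital_star_hom (X n) (X n.+1))
    (A : cstarAlgType R) (can : forall n, unital_star_hom (X n) A) : Prop :=
  (forall n, can n.+1 \o f n =1 can n) /\
  forall (C : cstarAlgType R) (g : forall n, unital_star_hom (X n) C),
    (forall n, g n.+1 \o f n =1 g n) ->
    exists h : unital_star_hom A C, (forall n, h \o can n =1 g n) /\
      forall h' : unital_star_hom A C, (forall n, h' \o can n =1 g n) -> h' =1 h.

Section CanonicalLip.
Variables (R : realType) (X : nat -> cqms R) (A : cstarAlgType R).
Variable can : forall n, unital_star_hom (X n) A.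
Local Open Scope ereal_scope.

(* x / (1 + x), extended by continuity at +oo. *)
Definition bounded_transform (x : \bar R) : \bar R :=
  if x is r%:E then (r / (1 + r))%:E else 1.

(* Sequences are indexed from 0, so the n-th weight is 2^-(n+1). *)
Definition limit_dist (mu nu : state A) : \bar R :=
  \sum_(0 <= n <oo) (2 ^- n.+1)%:E *
    bounded_transform (mk_dist (@cqms_lip R (X n))
      (pullback_state mu (can n)) (pullback_state nu (can n))).

(* The maximum with 0 only matters when A has a single state: the supremum
   of the empty set is -oo in \bar R, but 0 in [0, +oo]. *)
Definition canonical_lip (a : A) : \bar R :=
  maxe 0 (ereal_sup [set x | exists mu nu : state A,
    mu <> nu /\ x = state_dist mu nu a / limit_dist mu nu]).
End CanonicalLip.

Definition lipschitz_isomorphic (R : realType)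
    (A : cstarAlgType R) (LA : A -> \bar R)
    (B : cstarAlgType R) (LB : B -> \bar R) : Prop :=
  exists (Theta : unital_star_hom A B) (Theta' : B -> A),
    [/\ cancel Theta Theta', cancel Theta' Theta &
    exists lam gam : R, [/\ 0 < lam, 0 < gam,
      forall a, (LB (Theta a) <= lam%:E * LA a)%E &
      forall b, (LA (Theta' b) <= gam%:E * LB b)%E]].

(* Main.v *)
(* Write rho_A, rho_B for the metrics on the state spaces.  If
   L_B(psi(phi^n(x))) <= c L_{A_n}(x) for all n and x, then every Monge-Kantorovich
   distance in the series for rho_A(mu o psi, nu o psi) is at most c rho_B(mu, nu),
   and so is the series, because t/(1+t) <= t and its weights sum to 1.  Hence
   |mu(psi a) - nu(psi a)| <= L_A(a) rho_A(mu o psi, nu o psi)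
   <= c L_A(a) rho_B(mu, nu), that is, L_B(psi(a)) <= c L_A(a).  The maps
   themselves, their inverse relations and uniqueness come from the universal
   property. *)
Require Import Defs.
From HB Require Import structures.
From mathcomp Require Import all_boot all_order all_algebra.
From mathcomp Require Import complex.
From mathcomp Require Import all_classical all_reals all_analysis.

Set Implicit Arguments.
Unset Strict Implicit.
Unset Printing Implicit Defensive.

Import Order.TTheory GRing.Theory Num.Theory.
Import numFieldNormedType.Exports.

Local Open Scope classical_set_scope.
Local Open Scope ring_scope.

Section BoundedTransform.
Variable R : realType.
Local Open Scope ereal_scope.
Implicit Types x : \bar R.

Lemma bounded_transform_ge0 x : 0 <= x -> 0 <= bounded_transform x.
Proof.
case: x => [r| |] //= r0; rewrite lee_fin in r0.
by rewrite lee_fin divr_ge0// addr_ge0.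
Qed.

Lemma bounded_transform_le1 x : 0 <= x -> bounded_transform x <= 1.
Proof.
case: x => [r| |] //= r0; rewrite lee_fin in r0.
by rewrite lee_fin ler_pdivrMr ?mul1r ?lerDr// ltr_pwDl.
Qed.

Lemma bounded_transform_le x : 0 <= x -> bounded_transform x <= x.
Proof.
case: x => [r| |] //= r0; last by rewrite leey.
rewrite lee_fin in r0; rewrite lee_fin ler_pdivrMr ?ltr_pwDl//.
by rewrite mulrDr mulr1 lerDl mulr_ge0.
Qed.

End BoundedTransform.

Lemma state_dist_ge0 (R : realType) (A : cstarAlgType R) (mu nu : state A) a :
  (0 <= state_dist mu nu a)%E.
Proof.
rewrite lee_fin; have := normr_ge0 (mu a - nu a).
by case: (`|_|) => x y /=; rewrite lecE/= => /andP[].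
Qed.

Lemma state_distxx (R : realType) (A : cstarAlgType R) (mu : state A) a :
  state_dist mu mu a = 0%E.
Proof. by rewrite /state_dist subrr normr0. Qed.

(** The element 0 lies in the ball over which the supremum is taken, so the value [-oo] of an empty
    supremum does not arise. *)
Lemma mk_dist_ge0 (R : realType) (X : cqms R) (mu nu : state X) :
  (0 <= mk_dist (@cqms_lip R X) mu nu)%E.
Proof.
apply: (le_trans (state_dist_ge0 mu nu 0)).
apply: ereal_sup_ubound; exists 0 => //=.
have [/lip_eq0 lip0 _] := cqms_lipP X.
by rewrite (lip0 0).2 ?lee01//; exists 0; rewrite scale0r.
Qed.

Section CanonicalLipTheory.
Variables (R : realType) (X : nat -> cqms R) (A : cstarAlgType R).
Variable can : forall n, unital_star_hom (X n) A.
Local Open Scope ereal_scope.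
Implicit Types mu nu : state A.

Lemma limit_dist_ge0 mu nu : 0 <= limit_dist can mu nu.
Proof.
apply: nneseries_ge0 => n _ _; apply: mule_ge0; first by rewrite lee_fin.
exact/bounded_transform_ge0/mk_dist_ge0.
Qed.

(** The weights [2 ^- n.+1] sum to 1, so a bound on the terms that is uniform in [n] carries over to
    the weighted series. *)
Lemma limit_dist_le mu nu (e : R) : (0 <= e)%R ->
  (forall n, bounded_transform (mk_dist (@cqms_lip R (X n))
     (pullback_state mu (can n)) (pullback_state nu (can n))) <= e%:E) ->
  limit_dist can mu nu <= e%:E.
Proof.
move=> e0 le_e; apply: le_trans (epsilon_trick0 xpredT e0).
apply: lee_nneseries => [n _ _|n _].
  apply: mule_ge0; first by rewrite lee_fin.
  exact/bounded_transform_ge0/mk_dist_ge0.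
by rewrite mulrC EFinM natrX; apply: lee_wpmul2l; rewrite ?lee_fin.
Qed.

(** The transform is at most 1 even at [+oo]. Finiteness is what later permits passing between a
    quotient by [limit_dist] and a product. *)
Lemma limit_dist_fin_num mu nu : limit_dist can mu nu \is a fin_num.
Proof.
rewrite ge0_fin_numE ?limit_dist_ge0//.
apply: (@le_lt_trans _ _ 1%:E); last exact: ltry.
apply: limit_dist_le => // n; exact/bounded_transform_le1/mk_dist_ge0.
Qed.

Lemma canonical_lip_ge0 a : 0 <= canonical_lip can a.
Proof. by rewrite /canonical_lip le_max lexx. Qed.

(* Holds even if [limit_dist can mu nu = 0] with [mu <> nu]: as [0^-1 = +oo] in
   [\bar R], a finite [canonical_lip can a] then forces [mu a = nu a]. *)
Lemma state_dist_le_canonical_lip mu nu a : canonical_lip can a < +oo ->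
  state_dist mu nu a <= canonical_lip can a * limit_dist can mu nu.
Proof.
move=> La_fin; have La0 := canonical_lip_ge0 a.
have [<-|mu_nu] := pselect (mu = nu).
  by rewrite state_distxx mule_ge0// limit_dist_ge0.
have: state_dist mu nu a / limit_dist can mu nu <= canonical_lip can a.
  by rewrite /canonical_lip le_max ereal_sup_ubound ?orbT//; exists mu, nu.
have := limit_dist_ge0 mu nu; rewrite -(fineK (limit_dist_fin_num mu nu)).
rewrite lee_fin le_eqVlt => /predU1P[<-|r_gt0].
  rewrite inve0 mule0 => /le_lt_trans/(_ La_fin).
  have := state_dist_ge0 mu nu a.
  by rewrite le_eqVlt => /predU1P[<-//|/gt0_muley ->]; rewrite ltxx.
by rewrite inver gt_eqF// lee_pdivrMr.
Qed.

End CanonicalLipTheory.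

Section LipschitzMap.
Variables (R : realType) (X Y : nat -> cqms R) (A B : cstarAlgType R).
Variables (canA : forall n, unital_star_hom (X n) A).
Variables (canB : forall n, unital_star_hom (Y n) B).
Variables (f : unital_star_hom A B) (c : R).
Hypothesis c_gt0 : (0 < c)%R.
Local Open Scope ereal_scope.
Hypothesis f_lip : forall n (x : X n),
  canonical_lip canB (f (canA n x)) <= c%:E * cqms_lip x.

(** For [x] in the unit Lipschitz ball of any stage, [f_lip] gives [f (canA n x)] canonical seminorm
    at most [c], so [mu] and [nu] differ there by at most [c] times their distance. This bound does
    not depend on [n]. *)
Lemma limit_dist_pullback mu nu :
  limit_dist canA (pullback_state mu f) (pullback_state nu f) <=
  c%:E * limit_dist canB mu nu.
Proof.
have rho0 := limit_dist_ge0 canB mu nu.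
rewrite -(fineK (limit_dist_fin_num canB mu nu)) -EFinM.
apply: limit_dist_le => [|n]; first by rewrite mulr_ge0 ?(ltW c_gt0)// fine_ge0.
apply: le_trans (bounded_transform_le (mk_dist_ge0 _ _)) _.
apply: ge_ereal_sup => _ [x /= x_le1 <-].
rewrite EFinM fineK ?limit_dist_fin_num//.
have Lx_le : canonical_lip canB (f (canA n x)) <= c%:E.
  apply: le_trans (f_lip x) _; rewrite -[leRHS]mule1.
  by apply: lee_wpmul2l; rewrite // lee_fin ltW.
apply: le_trans (lee_wpmul2r rho0 Lx_le).
by apply: state_dist_le_canonical_lip; apply: le_lt_trans Lx_le (ltry _).
Qed.

Lemma canonical_lip_hom_le a :
  canonical_lip canB (f a) <= c%:E * canonical_lip canA a.
Proof.
have La0 := canonical_lip_ge0 canA a.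
have [La_fin|] := boolP (canonical_lip canA a < +oo); last first.
  by rewrite -leNgt leye_eq => /eqP ->; rewrite gt0_muley ?leey ?lte_fin.
rewrite [leLHS]/canonical_lip ge_max mule_ge0 ?lee_fin ?(ltW c_gt0)//=.
apply: ge_ereal_sup => _ [mu [nu [_ ->]]].
have := state_dist_le_canonical_lip (pullback_state mu f) (pullback_state nu f) La_fin.
move=> /le_trans/(_ (lee_wpmul2l La0 (limit_dist_pullback mu nu))).
rewrite -[state_dist _ _ a]/(state_dist mu nu (f a)) muleA [_ * c%:E]muleC.
have := limit_dist_ge0 canB mu nu.
rewrite -(fineK (limit_dist_fin_num canB mu nu)) lee_fin.
(* At distance 0 the inverse is [+oo], but the bound just obtained makes the numerator vanish, and
   [0 * +oo = 0]. *)
rewrite [(0 <= _)%R]le_eqVlt => /predU1P[<-|r_gt0].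
  rewrite mule0 => d_le0.
  have /eqP -> : state_dist mu nu (f a) == 0 by rewrite eq_le d_le0 state_dist_ge0.
  by rewrite mul0e mule_ge0 ?lee_fin ?(ltW c_gt0).
by rewrite inver gt_eqF// lee_pdivrMr.
Qed.

End LipschitzMap.

Section UnitalStarHomCategory.
Variable R : realType.

Definition unital_star_hom_id (A : cstarAlgType R) : unital_star_hom A A :=
  @UnitalStarHom R A A idfun (fun _ _ => erefl) erefl (fun _ => erefl).

Variables (A B C : cstarAlgType R).
Variables (g : unital_star_hom B C) (f : unital_star_hom A B).

Let gf : {linear A -> C} := star_hom_fun g \o star_hom_fun f.

Lemma unital_star_hom_compM : {morph gf : a b / cmul a b}.
Proof. by move=> a b; rewrite /gf /= !star_homM. Qed.

Lemma unital_star_hom_comp1 : gf cone = cone.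
Proof. by rewrite /gf /= !star_hom1. Qed.

Lemma unital_star_hom_comp_star : {morph gf : a / star a}.
Proof. by move=> a; rewrite /gf /= !star_hom_star. Qed.

Definition unital_star_hom_comp : unital_star_hom A C :=
  UnitalStarHom unital_star_hom_compM unital_star_hom_comp1
    unital_star_hom_comp_star.

End UnitalStarHomCategory.

(** Both maps mediate the cocone [k \o can n], and mediating maps are unique. This gives the inverse
    relations as well as the uniqueness of the pair. *)
Lemma inductive_limit_hom_eq (R : realType) (X : nat -> cstarAlgType R)
    (f : forall n, unital_star_hom (X n) (X n.+1)) (A C : cstarAlgType R)
    (can : forall n, unital_star_hom (X n) A) (h k : unital_star_hom A C) :
  is_inductive_limit f can -> (forall n, h \o can n =1 k \o can n) -> h =1 k.
Proof.
move=> [canS univ] hk.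
have [|u [_ u_uniq]] := univ C (fun n => unital_star_hom_comp k (can n)).
  by move=> n x /=; rewrite -(canS n x).
by move=> a; rewrite (u_uniq h hk) (u_uniq k (fun _ _ => erefl)).
Qed.

Theorem theorem4p7 (R : realType)
  (A_ B_ : nat -> cqms R)
  (phi_ : forall n, unital_star_hom (A_ n) (A_ n.+1))
  (vphi_ : forall n, unital_star_hom (B_ n) (B_ n.+1))
  (phi_dom : forall n, dom_preserving (phi_ n))
  (vphi_dom : forall n, dom_preserving (vphi_ n))
  (A B : cstarAlgType R)
  (phi : forall n, unital_star_hom (A_ n) A)
  (vphi : forall n, unital_star_hom (B_ n) B)
  (A_lim : is_inductive_limit phi_ phi)
  (B_lim : is_inductive_limit vphi_ vphi)
  (psi_ : forall n, unital_star_hom (A_ n) (B_ n))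
  (Psi_ : forall n, unital_star_hom (B_ n) (A_ n.+1))
  (Psi_psi : forall n, Psi_ n \o psi_ n =1 phi_ n)
  (psi_Psi : forall n, psi_ n.+1 \o Psi_ n =1 vphi_ n)
  (psi_phi : forall n, psi_ n.+1 \o phi_ n =1 vphi_ n \o psi_ n)
  (lam gam : nat -> R)
  (lam_gt0 : forall n, 0 < lam n)
  (gam_gt0 : forall n, 0 < gam n)
  (lam_bounded : has_ubound (range lam))
  (gam_bounded : has_ubound (range gam))
  (lam_lip : forall n (a : A_ n),
    (canonical_lip vphi (vphi n (psi_ n a)) <= (lam n)%:E * cqms_lip a)%E)
  (gam_lip : forall n (b : B_ n),
    (canonical_lip phi (phi n.+1 (Psi_ n b)) <= (gam n)%:E * cqms_lip b)%E) :
  let LA := canonical_lip phi in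
  let LB := canonical_lip vphi in
  let good (psi : unital_star_hom A B) (Psi : unital_star_hom B A) :=
    [/\ psi \o Psi =1 id /\ Psi \o psi =1 id,
        forall n, [/\ psi \o phi n =1 vphi n \o psi_ n,
                      Psi \o vphi n =1 phi n.+1 \o Psi_ n &
                      phi n.+1 \o Psi_ n \o psi_ n =1 phi n],
        forall a : A, (LB (psi a) <= (2 * sup (range lam))%:E * LA a)%E &
        forall b : B, (LA (Psi b) <= (2 * sup (range gam))%:E * LB b)%E] in
  (exists (psi : unital_star_hom A B) (Psi : unital_star_hom B A),
    good psi Psi /\
    forall (psi' : unital_star_hom A B) (Psi' : unital_star_hom B A),
      good psi' Psi' -> psi' =1 psi /\ Psi' =1 Psi) /\
  lipschitz_isomorphic LA LB.
Proof.
move=> LA LB good.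
have [phiS A_univ] := A_lim; have [vphiS B_univ] := B_lim.
have [|psi [psiE _]] := A_univ B (fun n => unital_star_hom_comp (vphi n) (psi_ n)).
  by move=> n x /=; rewrite -(vphiS n) /=; have /= -> := psi_phi n x.
have [|Psi [PsiE _]] :=
    B_univ A (fun n => unital_star_hom_comp (phi n.+1) (Psi_ n)).
  (* Cocone condition: replace [vphi_ n] by [psi_ n.+1 \o Psi_ n], then contract
     [Psi_ n.+1 \o psi_ n.+1] to [phi_ n.+1], which [phi n.+2] absorbs. *)
  move=> n y /=; have /= <- := psi_Psi n y; have /= -> := Psi_psi n.+1 (Psi_ n y).
  exact: phiS.
have psiPsi : psi \o Psi =1 id.
  apply: (@inductive_limit_hom_eq _ _ _ _ _ _ (unital_star_hom_comp psi Psi)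
    (unital_star_hom_id B) B_lim) => n y /=.
  (* On the image of [vphi n] the composite climbs one stage: it is
     [vphi n.+1 \o psi_ n.+1 \o Psi_ n], that is, [vphi n.+1 \o vphi_ n]. *)
  have /= -> := PsiE n y; have /= -> := psiE n.+1 (Psi_ n y).
  by have /= -> := psi_Psi n y; exact: vphiS.
have Psipsi : Psi \o psi =1 id.
  apply: (@inductive_limit_hom_eq _ _ _ _ _ _ (unital_star_hom_comp Psi psi)
    (unital_star_hom_id A) A_lim) => n x /=.
  have /= -> := psiE n x; have /= -> := PsiE n (psi_ n x).
  by have /= -> := Psi_psi n x; exact: phiS.
have le2sup (u : nat -> R) : (forall n, 0 < u n) -> has_ubound (range u) ->
    0 < 2 * sup (range u) /\ forall n, u n <= 2 * sup (range u).
  move=> u_gt0 u_ub.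
  (* Boundedness makes [sup] a genuine supremum; on an unbounded set it would default to 0. *)
  have u_le n : u n <= sup (range u) by apply: ub_le_sup => //; exists n.
  have sup_gt0 : 0 < sup (range u) := lt_le_trans (u_gt0 0%N) (u_le 0%N).
  split=> [|n]; first exact: mulr_gt0.
  by rewrite (le_trans (u_le n))// ler_peMl ?ltW// ltr1n.
have [lam2_gt0 lam_le] := le2sup lam lam_gt0 lam_bounded.
have [gam2_gt0 gam_le] := le2sup gam gam_gt0 gam_bounded.
have lip_ge0' (X : cqms R) (x : X) : (0 <= cqms_lip x)%E.
  by have [/lip_ge0] := cqms_lipP X.
(* Since seminorms are nonnegative, the stagewise constants can all be enlarged to one constant, as
   [canonical_lip_hom_le] requires. *)
have psi_lip a : (LB (psi a) <= (2 * sup (range lam))%:E * LA a)%E.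
  apply: canonical_lip_hom_le => // n x; have /= -> := psiE n x.
  by apply: le_trans (lam_lip n x) _; rewrite lee_wpmul2r ?lee_fin.
have Psi_lip b : (LA (Psi b) <= (2 * sup (range gam))%:E * LB b)%E.
  apply: canonical_lip_hom_le => // n y; have /= -> := PsiE n y.
  by apply: le_trans (gam_lip n y) _; rewrite lee_wpmul2r ?lee_fin.
split; last first.
  exists psi, Psi; split=> //.
  by exists (2 * sup (range lam)), (2 * sup (range gam)).
exists psi, Psi; split.
  split=> // n; split=> [||x /=]; [exact: psiE|exact: PsiE|].
  by have /= -> := Psi_psi n x; exact: phiS.
(* The commutation relations fix [psi'] and [Psi'] on the images of the canonical maps, which
   determine a homomorphism out of the limit. *)
move=> psi' Psi' [_ commute' _ _]; split.
  apply: inductive_limit_hom_eq A_lim _ => n x.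
  by have [/(_ x) -> _ _] := commute' n; rewrite psiE.
apply: inductive_limit_hom_eq B_lim _ => n y.
by have [_ /(_ y) -> _] := commute' n; rewrite PsiE.
Qed.
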